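(* Let $R$ be a commutative noetherian ring with finite pure global dimension and let $S\subseteq R$ be a multiplicative subset. Put $$\mathbb{X}=\mathsf{Add}(\mathsf{sub}\{S\text{-torsion free modules}\})=\mathsf{Add}\{\text{finitely generated }S\text{-torsion free modules}\}.$$ Then $\mathsf{K}(\mathbb{X})$ is compactly generated.
   Context: For a module $M$, its $S$-torsion submodule is $\Gamma_SM=\{x\in M\mid sx=0\text{ for some }s\in S\}$, and $M$ is $S$-torsion free if $\Gamma_SM=0$. $\mathsf{mod}\,R$ is the class of finitely presented modules. For a class $\mathbb{A}$ of modules, $\mathsf{sub}\,\mathbb{A}=\{N\in\mathsf{mod}\,R\mid N\subseteq A\text{ for some }A\in\mathbb{A}\}$, and $\mathsf{Add}\,\mathbb{A}$ is the class of modules isomorphic to a direct summand of a coproduct $\coprod_{i\in I}A_i$ with $A_i\in\mathbb{A}$, $I$ an arbitrary set. For a class $\mathbb{X}=\mathsf{Add}\,\mathbb{X}$, $\mathsf{K}(\mathbb{X})$ is the triangulated category with objects the ($\mathbb{Z}$-indexed) chain complexes of modules from $\mathbb{X}$ and morphisms the chain maps modulo homotopy. A triangulated category $\mathsf{T}$ with set-indexed coproducts is compactly generated if there is a set $\mathcal{G}$ of compact objects (objects $C$ for which $\coprod_i\operatorname{Hom}_{\mathsf T}(C,X_i)\to\operatorname{Hom}_{\mathsf T}(C,\coprod_iX_i)$ is always an isomorphism) such that, for all $X\in\mathsf{T}$, $\operatorname{Hom}_{\mathsf T}(G,X)=0$ for all $G\in\mathcal{G}$ implies $X\cong0$. A sequence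 $Y$ of modules is pure exact if $\operatorname{Hom}_R(N,Y)$ is exact for every finitely presented module $N$. A module $P$ is pure projective if $\operatorname{Hom}_R(P,-)$ preserves exactness of pure exact sequences. The pure global dimension of $R$ is the least $d$ (or $\infty$) such that every module $N$ has a pure exact sequence $0\to P_d\to\cdots\to P_0\to N\to0$ with all $P_i$ pure projective. *)

(* Defs.v *)
From HB Require Import structures.
From mathcomp Require Import all_boot all_algebra all_classical.

Set Implicit Arguments.
Unset Strict Implicit.
Unset Printing Implicit Defensive.

Import GRing.Theory.
Local Open Scope classical_set_scope.
Local Open Scope ring_scope.

(* Direct sums, realized as the finitely supported families.

   Sets versus classes: index sets are choiceTypes.  Classically every type is
   a choiceType, so the only content is the universe level: since [lsum V] is
   an R-module for every I : choiceType, index types live in the universe of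
   the carriers of modules, and neither the type of all modules nor the type
   of all complexes of modules can be used as an index set. *)

Record dsum (I : choiceType) (V : I -> zmodType) := DSum {
  dsum_fun :> forall i, V i;
  dsum_fin : finite_set [set i | dsum_fun i != 0] }.

Section DirectSum.
Variables (I : choiceType) (V : I -> zmodType).
Implicit Types u v w : dsum V.

HB.instance Definition _ := gen_eqMixin (dsum V).
HB.instance Definition _ := gen_choiceMixin (dsum V).

Lemma dsumP u v : (forall i, u i = v i) -> u = v.
Proof.
case: u v => [u uP] [v vP] /= uv.
have {}uv : u = v by apply: functional_extensionality_dep.
by case: v / uv vP => vP; rewrite (Prop_irrelevance uP vP).
Qed.

Fact dsum0_fin : finite_set [set i | (0 : V i) != 0].
Proof. by apply: (sub_finite_set _ (finite_set0 I)) => i /=; rewrite eqxx. Qed.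

Fact dsumN_fin u : finite_set [set i | - u i != 0].
Proof. by apply: sub_finite_set (dsum_fin u) => i /=; rewrite oppr_eq0. Qed.

Fact dsumD_fin u v : finite_set [set i | u i + v i != 0].
Proof.
have : finite_set ([set i | u i != 0] `|` [set i | v i != 0]).
  by rewrite finite_setU; split; apply: dsum_fin.
apply: sub_finite_set => i /= uv0; have [ui0|] := eqVneq (u i) 0; last by left.
by right; rewrite ui0 add0r in uv0.
Qed.

Definition dsum0 := DSum dsum0_fin.
Definition dsumN u := DSum (dsumN_fin u).
Definition dsumD u v := DSum (dsumD_fin u v).

Fact dsumDA : associative dsumD.
Proof. by move=> u v w; apply: dsumP => i /=; rewrite addrA. Qed.
Fact dsumDC : commutative dsumD.
Proof. by move=> u v; apply: dsumP => i /=; rewrite addrC. Qed.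
Fact dsum0D : left_id dsum0 dsumD.
Proof. by move=> u; apply: dsumP => i /=; rewrite add0r. Qed.
Fact dsumND : left_inverse dsum0 dsumN dsumD.
Proof. by move=> u; apply: dsumP => i /=; rewrite addNr. Qed.

HB.instance Definition _ :=
  GRing.isZmodule.Build (dsum V) dsumDA dsumDC dsum0D dsumND.

End DirectSum.

Definition lsum (R : pzRingType) (I : choiceType) (V : I -> lmodType R) :=
  dsum V.

Section ModuleDirectSum.
Variables (R : pzRingType) (I : choiceType) (V : I -> lmodType R).
Implicit Types u v : lsum V.

HB.instance Definition _ := GRing.Zmodule.on (lsum V).

Fact lsumZ_fin a u : finite_set [set i | a *: (u i : V i) != 0].
Proof.
apply: sub_finite_set (dsum_fin u) => i /=.
by apply: contra_neq => ->; rewrite scaler0.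
Qed.

Definition lsumZ a u : lsum V := DSum (@lsumZ_fin a u).

Fact lsumZA a b u : lsumZ a (lsumZ b u) = lsumZ (a * b) u.
Proof. by apply: dsumP => i /=; rewrite scalerA. Qed.
Fact lsum1Z : left_id 1 lsumZ.
Proof. by move=> u; apply: dsumP => i /=; rewrite scale1r. Qed.
Fact lsumZDr : right_distributive lsumZ +%R.
Proof. by move=> a u v; apply: dsumP => i /=; rewrite scalerDr. Qed.
Fact lsumZDl u : {morph lsumZ^~ u : a b / a + b}.
Proof. by move=> a b; apply: dsumP => i /=; rewrite scalerDl. Qed.

HB.instance Definition _ :=
  GRing.Zmodule_isLmodule.Build R (lsum V) lsumZA lsum1Z lsumZDr lsumZDl.

End ModuleDirectSum.

(* Rings and modules.  A class of modules is a predicate on [lmodType R]; all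
   the predicates below that are used as classes are invariant under
   isomorphism. *)

Definition ideal (R : comPzRingType) (J : set R) :=
  J 0 /\ forall a x y, J x -> J y -> J (a * x + y).

Definition noetherian (R : comPzRingType) :=
  forall J : set R, ideal J ->
    exists (n : nat) (g : 'I_n -> R),
      J = [set x | exists c : 'I_n -> R, x = \sum_i c i * g i].

Definition multiplicative (R : comPzRingType) (S : set R) :=
  S 1 /\ forall s t, S s -> S t -> S (s * t).

Section Modules.
Variable R : comPzRingType.
Implicit Types (M N P : lmodType R) (A : lmodType R -> Prop).

Definition torsion (S : set R) M : set M :=
  [set x | exists2 s, S s & s *: x = 0].
Arguments torsion S M : clear implicits.

Definition torsion_free (S : set R) M := torsion S M = [set 0].

Definition fin_gen M :=
  exists (n : nat) (p : {linear 'rV[R]_n -> M}), set_surj setT setT p.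

Definition fin_pres M :=
  exists (m n : nat) (q : {linear 'rV[R]_m -> 'rV[R]_n})
         (p : {linear 'rV[R]_n -> M}),
    set_surj setT setT p /\ [set x | p x = 0] = range q.

Definition sub A N :=
  fin_pres N /\
  exists M, A M /\ exists f : {linear N -> M}, injective f.

Definition Add A M :=
  exists (I : choiceType) (V : I -> lmodType R),
    (forall i, A (V i)) /\
    exists N (f : {linear (M * N)%type -> lsum V}), bijective f.

(* Exactness at the middle term of Hom(N, L) -> Hom(N, M) -> Hom(N, P).  A
   longer sequence is (pure) exact when it is so at each of its inner terms. *)
Definition hom_exact N (L M P : lmodType R)
    (f : {linear L -> M}) (g : {linear M -> P}) :=
  forall h : {linear N -> M},
    (forall x, g (h x) = 0) <->
    exists k : {linear N -> L}, forall x, h x = f (k x).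

Definition pure_exact (L M P : lmodType R)
    (f : {linear L -> M}) (g : {linear M -> P}) :=
  forall N, fin_pres N -> hom_exact N f g.

Definition pure_projective N :=
  forall (L M P : lmodType R) (f : {linear L -> M}) (g : {linear M -> P}),
    pure_exact f g -> hom_exact N f g.

(* The resolution 0 -> P_d -> ... -> P_0 -> N -> 0 is extended to the left by
   zero modules; its right end is N -> 0, with 'rV[R]_0 as the zero module. *)
Definition pure_gldim_le (d : nat) :=
  forall N, exists (P : nat -> lmodType R)
      (f : forall n, {linear P n.+1 -> P n}) (e : {linear P 0%N -> N}),
    [/\ forall n, pure_projective (P n),
        forall n, (d < n)%N -> forall x : P n, x = 0,
        forall n, pure_exact (f n.+1) (f n),
        pure_exact (f 0%N) e
      & pure_exact e (\0 : {linear N -> 'rV[R]_0})].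

End Modules.

Definition finite_pure_gldim (R : comPzRingType) :=
  exists d, pure_gldim_le R d.

(* Categories enriched in abelian groups. *)

Record preadditive := Preadditive {
  ob :> Type;
  hom : ob -> ob -> zmodType;
  idm : forall X, hom X X;
  comp : forall X Y Z, hom Y Z -> hom X Y -> hom X Z;
  compA : forall W X Y Z (h : hom Y Z) (g : hom X Y) (f : hom W X),
    comp h (comp g f) = comp (comp h g) f;
  comp1m : forall X Y (f : hom X Y), comp (idm Y) f = f;
  compm1 : forall X Y (f : hom X Y), comp f (idm X) = f;
  compDl : forall X Y Z (g g' : hom Y Z) (f : hom X Y),
    comp (g + g') f = comp g f + comp g' f;
  compDr : forall X Y Z (g : hom Y Z) (f f' : hom X Y),
    comp g (f + f') = comp g f + comp g f' }.

Arguments idm {p} X.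
Arguments comp {p X Y Z} _ _.

Section CompactGeneration.
Variable T : preadditive.

Definition zero_object (X : T) :=
  (forall Y (f : hom X Y), f = 0) /\ (forall Y (f : hom Y X), f = 0).

Definition is_coproduct (I : choiceType) (X : I -> T) (D : T)
    (inj : forall i, hom (X i) D) :=
  forall (Y : T) (g : forall i, hom (X i) Y),
    exists! f : hom D Y, forall i, comp f (inj i) = g i.

(* The canonical map from the direct sum of the Hom(C, X_i) to Hom(C, D); the
   sum is finite because the family phi is finitely supported. *)
Definition hom_coprod (C : T) (I : choiceType) (X : I -> T) (D : T)
    (inj : forall i, hom (X i) D) (phi : dsum (fun i => hom C (X i))) :
    hom C D :=
  \sum_(i \in [set: I]) comp (inj i) (phi i).

Definition compact (C : T) :=
  forall (I : choiceType) (X : I -> T) (D : T) (inj : forall i, hom (X i) D),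
    is_coproduct inj -> bijective (@hom_coprod C I X D inj).

Definition has_coproducts :=
  forall (I : choiceType) (X : I -> T),
    exists (D : T) (inj : forall i, hom (X i) D), is_coproduct inj.

(* The triangulated structure is not mentioned: the definition involves only
   the underlying additive category. *)
Definition compactly_generated :=
  has_coproducts /\
  exists (J : choiceType) (G : J -> T),
    (forall j, compact (G j)) /\
    forall X : T, (forall j (f : hom (G j) X), f = 0) -> zero_object X.

End CompactGeneration.

(* Chain complexes.  To avoid transports along n - 1 + 1 = n, the differential
   out of degree n + 1 is indexed by its target degree n, and identities that
   concern degree n are stated in degree n + 1. *)

Record complex (R : comPzRingType) (A : lmodType R -> Prop) := Complex {
  ch :> int -> lmodType R;
  ch_in : forall n : int, A (ch n);
  diff : forall n : int, {linear ch (n + 1) -> ch n};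
  diffK : forall (n : int) x, diff n (diff (n + 1) x) = 0 }.

Arguments diff {R A} c n.

Section ChainMaps.
Variables (R : comPzRingType) (A : lmodType R -> Prop).
Implicit Types W X Y Z : complex A.

Unset Implicit Arguments.
Record chmap X Y := ChMap {
  chm :> forall n : int, X n -> Y n;
  chm_linear : forall n : int, linear (chm n);
  chm_diff : forall (n : int) x, chm n (diff X n x) = diff Y n (chm (n + 1) x) }.
Set Implicit Arguments.
Arguments ChMap {X Y} chm _ _.
Arguments chm {X Y} c n x.
Arguments chm_linear {X Y} c n.
Arguments chm_diff {X Y} c n x.

HB.instance Definition _ X Y (f : chmap X Y) n :=
  GRing.isLinear.Build R (X n) (Y n) *:%R (f n) (chm_linear f n).

HB.instance Definition _ X Y := gen_eqMixin (chmap X Y).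
HB.instance Definition _ X Y := gen_choiceMixin (chmap X Y).

Lemma chmapP X Y (f g : chmap X Y) : (forall n x, f n x = g n x) -> f = g.
Proof.
case: f g => [f fl fd] [g gl gd] /= fg.
have {}fg : f = g.
  by apply: functional_extensionality_dep => n; apply/funext => x.
case: g / fg gl gd => gl gd.
by rewrite (Prop_irrelevance fl gl) (Prop_irrelevance fd gd).
Qed.

Definition chmap1 X : chmap X X :=
  ChMap (fun n x => x) (fun _ _ _ _ => erefl) (fun _ _ => erefl).

Fact chmap_comp_linear X Y Z (g : chmap Y Z) (f : chmap X Y) n :
  linear (fun x => g n (f n x)).
Proof. by move=> a x y; rewrite !linearP. Qed.

Fact chmap_comp_diff X Y Z (g : chmap Y Z) (f : chmap X Y) (n : int) x :
  g n (f n (diff X n x)) = diff Z n (g (n + 1) (f (n + 1) x)).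
Proof. by rewrite !chm_diff. Qed.

Definition chmap_comp X Y Z (g : chmap Y Z) (f : chmap X Y) : chmap X Z :=
  ChMap (fun n x => g n (f n x))
    (chmap_comp_linear g f) (chmap_comp_diff g f).

Fact chmap0_linear X Y n : linear (fun _ : X n => 0 : Y n).
Proof. by move=> a x y; rewrite scaler0 addr0. Qed.

Fact chmap0_diff X Y (n : int) (x : X (n + 1)) : 0 = diff Y n 0.
Proof. by rewrite linear0. Qed.

Definition chmap0 X Y : chmap X Y :=
  ChMap (fun n _ => 0) (@chmap0_linear X Y) (@chmap0_diff X Y).

Fact chmapN_linear X Y (f : chmap X Y) n : linear (fun x => - f n x).
Proof. by move=> a x y; rewrite linearP opprD scalerN. Qed.

Fact chmapN_diff X Y (f : chmap X Y) (n : int) x :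
  - f n (diff X n x) = diff Y n (- f (n + 1) x).
Proof. by rewrite chm_diff linearN. Qed.

Definition chmapN X Y (f : chmap X Y) : chmap X Y :=
  ChMap (fun n x => - f n x) (chmapN_linear f) (chmapN_diff f).

Fact chmapD_linear X Y (f g : chmap X Y) n : linear (fun x => f n x + g n x).
Proof. by move=> a x y; rewrite !linearP scalerDr addrACA. Qed.

Fact chmapD_diff X Y (f g : chmap X Y) (n : int) x :
  f n (diff X n x) + g n (diff X n x) = diff Y n (f (n + 1) x + g (n + 1) x).
Proof. by rewrite !chm_diff linearD. Qed.

Definition chmapD X Y (f g : chmap X Y) : chmap X Y :=
  ChMap (fun n x => f n x + g n x) (chmapD_linear f g) (chmapD_diff f g).

Section Zmod.
Variables X Y : complex A.

Fact chmapDA : associative (@chmapD X Y).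
Proof. by move=> f g h; apply: chmapP => n x /=; rewrite addrA. Qed.
Fact chmapDC : commutative (@chmapD X Y).
Proof. by move=> f g; apply: chmapP => n x /=; rewrite addrC. Qed.
Fact chmap0D : left_id (@chmap0 X Y) (@chmapD X Y).
Proof. by move=> f; apply: chmapP => n x /=; rewrite add0r. Qed.
Fact chmapND : left_inverse (@chmap0 X Y) (@chmapN X Y) (@chmapD X Y).
Proof. by move=> f; apply: chmapP => n x /=; rewrite addNr. Qed.

HB.instance Definition _ :=
  GRing.isZmodule.Build (chmap X Y) chmapDA chmapDC chmap0D chmapND.

Definition null_homotopic (f : chmap X Y) :=
  exists s : forall n : int, {linear X n -> Y (n + 1)},
    forall (n : int) x, f (n + 1) x = diff Y (n + 1) (s (n + 1) x) + s n (diff X n x).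

Definition null_homotopicb (f : chmap X Y) : bool := `[< null_homotopic f >].

Fact null_homotopic_zmod_closed : zmod_closed null_homotopicb.
Proof.
split=> [|f g /asboolP[s sP] /asboolP[t tP]]; apply/asboolP.
  by exists (fun n => \0) => n x /=; rewrite linear0 addr0.
exists (fun n => s n \- t n) => n x /=.
by rewrite sP tP linearB opprD addrACA.
Qed.

HB.instance Definition _ :=
  GRing.isZmodClosed.Build (chmap X Y) null_homotopicb
    null_homotopic_zmod_closed.

Lemma null_homotopicP (f : chmap X Y) :
  reflect (null_homotopic f) (f \in null_homotopicb).
Proof. exact: asboolP. Qed.

Definition homotopies : zmodClosed (chmap X Y) :=
  GRing.ZmodClosed.clone _ null_homotopicb _.

Definition homK : zmodType := Quotient.quot homotopies.

Definition class (f : chmap X Y) : homK := \pi_(Quotient.quot homotopies)%qT f.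

Lemma classP (f g : chmap X Y) : class f = class g <-> null_homotopic (f - g).
Proof.
have eq_in : (f - g \in null_homotopicb) = (class f == class g).
  exact: (Quotient.idealrBE homotopies).
split=> [/eqP|/null_homotopicP]; rewrite -?eq_in; first by move/null_homotopicP.
by rewrite eq_in => /eqP.
Qed.

Definition rep (u : homK) : chmap X Y := repr (u : Quotient.quot homotopies).

Lemma repK u : class (rep u) = u.
Proof. exact: reprK. Qed.

Lemma class_rep f : null_homotopic (rep (class f) - f).
Proof. by apply/classP; rewrite repK. Qed.

Lemma classD f g : class (f + g) = class f + class g.
Proof. by rewrite /class -[RHS]raddfD. Qed.

End Zmod.

Lemma null_homotopic_compr X Y Z (g : chmap Y Z) (f : chmap X Y) :
  null_homotopic f -> null_homotopic (chmap_comp g f).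
Proof.
move=> [s sP]; exists (fun n => g (n + 1) \o s n) => n x /=.
by rewrite sP linearD /= chm_diff.
Qed.

Lemma null_homotopic_compl X Y Z (g : chmap Y Z) (f : chmap X Y) :
  null_homotopic g -> null_homotopic (chmap_comp g f).
Proof.
move=> [s sP]; exists (fun n => s n \o f n) => n x /=.
by rewrite sP chm_diff.
Qed.

Definition compK X Y Z (v : homK Y Z) (u : homK X Y) : homK X Z :=
  class (chmap_comp (rep v) (rep u)).

Lemma class_comp X Y Z (g : chmap Y Z) (f : chmap X Y) :
  compK (class g) (class f) = class (chmap_comp g f).
Proof.
apply: (@etrans _ _ (class (chmap_comp (rep (class g)) f))); apply/classP.
  have -> : chmap_comp (rep (class g)) (rep (class f)) -
      chmap_comp (rep (class g)) f =
      chmap_comp (rep (class g)) (rep (class f) - f).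
    by apply: chmapP => n x /=; rewrite linearB.
  exact/null_homotopic_compr/class_rep.
have -> : chmap_comp (rep (class g)) f - chmap_comp g f =
    chmap_comp (rep (class g) - g) f by apply: chmapP.
exact/null_homotopic_compl/class_rep.
Qed.

Fact compKA W X Y Z (h : homK Y Z) (g : homK X Y) (f : homK W X) :
  compK h (compK g f) = compK (compK h g) f.
Proof.
rewrite -[h]repK -[g]repK -[f]repK !class_comp.
by congr class; apply: chmapP.
Qed.

Fact compK1m X Y (f : homK X Y) : compK (class (chmap1 Y)) f = f.
Proof. by rewrite -[f]repK class_comp; congr class; apply: chmapP. Qed.

Fact compKm1 X Y (f : homK X Y) : compK f (class (chmap1 X)) = f.
Proof. by rewrite -[f]repK class_comp; congr class; apply: chmapP. Qed.

Fact compKDl X Y Z (g g' : homK Y Z) (f : homK X Y) :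
  compK (g + g') f = compK g f + compK g' f.
Proof.
rewrite -[g]repK -[g']repK -[f]repK !(class_comp, =^~ classD).
by congr class; apply: chmapP.
Qed.

Fact compKDr X Y Z (g : homK Y Z) (f f' : homK X Y) :
  compK g (f + f') = compK g f + compK g f'.
Proof.
rewrite -[g]repK -[f]repK -[f']repK !(class_comp, =^~ classD).
by congr class; apply: chmapP => n x /=; rewrite linearD.
Qed.

End ChainMaps.

(* The homotopy category K(A) of complexes of modules from the class A. *)
Definition K (R : comPzRingType) (A : lmodType R -> Prop) : preadditive :=
  @Preadditive (complex A) (@homK R A) (fun X => class (chmap1 X))
    (@compK R A) (@compKA R A) (@compK1m R A) (@compKm1 R A) (@compKDl R A)
    (@compKDr R A).

(* Main.v *)
Require Import Defs.
From mathcomp Require Import all_boot all_algebra all_classical.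
From HB Require Import structures.

(** Every module has a largest [S]-torsion free quotient, so among the finitely
    generated modules the [S]-torsion free ones detect pure exactness of
    complexes of [S]-torsion free modules. This gives the generators: the
    finitely generated [S]-torsion free modules [Q], placed in a single degree.

    They are compact, because a morphism in the homotopy category from [Q] in
    degree [n] to [X] is a cycle of [Hom(Q, X)] in degree [n] modulo boundaries,
    and [Hom(Q, -)] commutes with direct sums when [Q] is finitely generated
    ([concentrated_compact]).

    They generate. If they have only zero morphisms to [X], then [Hom(Q, X)] is
    exact for all these [Q]. A homomorphism from a finitely presented module [N]
    to a term of [X] factors through its image, which is finitely generated and,
    as a submodule of a torsion free module, one of the [Q]; hence [Hom(N, X)] is
    exact, that is, [X] is pure exact ([gen_complex_pure_exact]). The terms of
    [X] are pure projective, being summands of direct sums of finitely presented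
    modules. So the terms of [X] above degree [n] are a pure projective
    resolution of the cycles in degree [n]. Comparison with a resolution of
    length [d] shows that this resolution splits from degree [d] on
    ([resolution_splits]). As [n] is arbitrary, [X] splits everywhere and is
    contractible ([pure_exact_contractible]).

    The ring is noetherian in order that finitely generated modules are finitely
    presented, which also identifies the two descriptions of the class of
    modules. *)

Set Implicit Arguments.
Unset Strict Implicit.
Unset Printing Implicit Defensive.

Import GRing.Theory.
(* So that [hom], [comp] and [multiplicative] denote the notions defined there. *)
Import Defs.
Local Open Scope classical_set_scope.
Local Open Scope ring_scope.

(** * Families indexed by a choice type *)

Lemma dep_choice (I : Type) (T : I -> Type) (P : forall i, T i -> Prop) :
  (forall i, exists x, P i x) -> exists f : forall i, T i, forall i, P i (f i).
Proof.
by move=> /(_ _)/cid Pf; exists (fun i => projT1 (Pf i)) => i; apply: projT2 (Pf i).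
Qed.

Lemma dsum_supp (I : choiceType) (V : I -> zmodType) (u : dsum V) :
  exists2 r : seq I, uniq r & forall i, u i != 0 -> i \in r.
Proof.
have /finite_seqP[r rP] := dsum_fin u.
exists (undup r); first exact: undup_uniq.
by move=> i ui; rewrite mem_undup; suff : [set` r] i by []; rewrite -rP.
Qed.

Section Delta.
Variables (R : pzRingType) (I : choiceType) (V : I -> lmodType R).

(** The identity of [V i] when [i = j], which spares transports along equalities
    of indices, and zero otherwise. *)
Definition delta i j : {linear V i -> V j} :=
  if @eqP _ i j is ReflectT e then ecast k {linear V i -> V k} e idfun else \0.

Lemma delta_id i x : delta i i x = x.
Proof. by rewrite /delta; case: eqP => // e; rewrite eq_axiomK. Qed.

Lemma delta_ne i j x : i != j -> delta i j x = 0.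
Proof. by rewrite /delta; case: eqP. Qed.

End Delta.
Arguments delta {R I} V i j.

(** * Direct sums *)

Section DirectSums.
Variables (R : pzRingType) (I : choiceType) (V : I -> lmodType R).

Fact lsum_proj_linear j : linear (fun u : lsum V => u j).
Proof. by []. Qed.
Definition lsum_proj j : {linear lsum V -> V j} :=
  HB.pack_for {linear lsum V -> V j} (fun u : lsum V => u j)
    (GRing.isLinear.Build R _ _ _ _ (lsum_proj_linear j)).

Fact lsum_inj_fin i (x : V i) : finite_set [set j | delta V i j x != 0].
Proof.
apply: sub_finite_set (finite_set1 i) => j /=.
by apply: contra_neqP => /eqP ji; rewrite delta_ne // eq_sym.
Qed.

Fact lsum_inj_linear i : linear (fun x : V i => DSum (lsum_inj_fin x) : lsum V).
Proof. by move=> a x y; apply: dsumP => j; apply: linearP. Qed.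
Definition lsum_inj i : {linear V i -> lsum V} :=
  HB.pack_for {linear V i -> lsum V} (fun x => DSum (lsum_inj_fin x) : lsum V)
    (GRing.isLinear.Build R _ _ _ _ (@lsum_inj_linear i)).

Lemma lsum_projE j u : lsum_proj j u = u j.
Proof. by []. Qed.

Lemma lsum_injE i x j : lsum_inj i x j = delta V i j x.
Proof. by []. Qed.

Section Copairing.
Variables (W : lmodType R) (g : forall i, {linear V i -> W}).

Definition copair_fun (u : lsum V) : W := \sum_(i \in [set: I]) g i (u i).

Lemma copairE (r : seq I) (u : lsum V) :
  uniq r -> (forall i, u i != 0 -> i \in r) ->
  copair_fun u = \sum_(i <- r) g i (u i).
Proof.
move=> r_uniq ur; rewrite /copair_fun (fsbigE r) //; first last.
  move=> i _; apply: contraNeq => gi0; apply: ur.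
  by apply: contra_neq gi0 => ->; rewrite linear0.
by apply: eq_bigl => i; rewrite in_setT.
Qed.

Fact copair_linear : linear copair_fun.
Proof.
move=> a u v.
have /finite_seqP[r rP] : finite_set ([set i | u i != 0] `|` [set i | v i != 0]).
  by rewrite finite_setU; split; apply: dsum_fin.
have mem_r i : ((u i != 0) || (v i != 0)) -> i \in undup r.
  rewrite mem_undup => uv.
  suff : [set` r] i by []. by rewrite -rP; apply/orP.
rewrite !(@copairE (undup r)) ?undup_uniq //; last 3 first.
- by move=> i vi; apply: mem_r; rewrite vi orbT.
- by move=> i ui; apply: mem_r; rewrite ui.
- move=> i uvi; apply: mem_r; rewrite -negb_and; apply: contra_neqN uvi.
  by case/andP=> /eqP ui /eqP vi; rewrite /= ui vi scaler0 addr0.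
by rewrite scaler_sumr -big_split /=; apply: eq_bigr => i _; rewrite linearP.
Qed.

Definition copair : {linear lsum V -> W} :=
  HB.pack_for {linear lsum V -> W} copair_fun
    (GRing.isLinear.Build R _ _ _ _ copair_linear).

Lemma copair_inj i (x : V i) : copair (lsum_inj i x) = g i x.
Proof.
rewrite [LHS](@copairE [:: i]) //; first by rewrite big_seq1 lsum_injE delta_id.
move=> j; rewrite lsum_injE inE; apply: contra_neqT => ji.
by rewrite delta_ne // eq_sym.
Qed.

End Copairing.

Lemma lsum_decomp (r : seq I) (u : lsum V) :
  uniq r -> (forall i, u i != 0 -> i \in r) ->
  u = \sum_(i <- r) lsum_inj i (u i).
Proof.
move=> r_uniq ur; apply: dsumP => j.
rewrite -[RHS]/(lsum_proj j _) linear_sum.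
under eq_bigr => i _ do rewrite lsum_projE lsum_injE.
have [jr|jr] := boolP (j \in r).
  rewrite (bigD1_seq j) //= delta_id big1 ?addr0 // => i ij.
  by rewrite delta_ne.
have -> : u j = 0 by apply: contraNeq jr; apply: ur.
rewrite big_seq big1 // => i ir; rewrite delta_ne //.
by apply: contraNneq jr => <-.
Qed.

Lemma lsum_ext (W : lmodType R) (f g : {linear lsum V -> W}) :
  (forall i x, f (lsum_inj i x) = g (lsum_inj i x)) -> forall u, f u = g u.
Proof.
move=> fg u; have [r r_uniq ur] := dsum_supp u.
rewrite (lsum_decomp r_uniq ur) !linear_sum /=.
by apply: eq_bigr => i _; apply: fg.
Qed.

End DirectSums.
Arguments lsum_proj {R I} V j.
Arguments lsum_inj {R I} V i.
Arguments copair {R I V W} g.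
(* Simplification would otherwise expose the finitely supported families behind
   these maps. *)
#[global] Opaque lsum_proj lsum_inj copair.

(** * Quotients, liftings and factorizations *)

Section LinearMaps.
Variable R : pzRingType.
Implicit Types L M N P Q : lmodType R.

(** A function that becomes linear after an injective linear map is linear. *)
Lemma lift_inj M N Q (j : {linear Q -> M}) (h : {linear N -> M}) :
  injective j -> (forall x, exists y, j y = h x) ->
  exists k : {linear N -> Q}, forall x, j (k x) = h x.
Proof.
move=> j_inj /choice[k kP].
have k_lin : linear k by move=> a x y; apply: j_inj; rewrite linearP !kP linearP.
pose kL := GRing.isLinear.Build R N Q *:%R k k_lin.
by exists (HB.pack_for {linear N -> Q} k kL).
Qed.

Lemma linear_inv M N (f : {linear M -> N}) : bijective f ->
  exists g : {linear N -> M}, cancel f g /\ cancel g f.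
Proof.
move=> [g fK gK].
have [k kP] := @lift_inj N N M f idfun (can_inj fK)
  (fun x => ex_intro _ (g x) (gK x)).
exists k; split; last exact: kP.
by move=> x; apply: (can_inj fK); rewrite kP.
Qed.

End LinearMaps.

Section Quotient.
Variables (R : pzRingType) (M : lmodType R) (K : {pred M}).
Hypothesis K_submod : submod_closed K.

Let K_zmod := GRing.isZmodClosed.Build M K (GRing.submod_closedB K_submod).
Definition rel_zmod : zmodClosed M := HB.pack K K_zmod.

Definition quotient := Quotient.quot rel_zmod.
HB.instance Definition _ := GRing.Zmodule.on quotient.

Definition quot_pi (x : M) : quotient := \pi_(Quotient.quot rel_zmod)%qT x.

Lemma quot_piP x y : quot_pi x = quot_pi y <-> x - y \in K.
Proof.
have e : (x - y \in K) = (quot_pi x == quot_pi y).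
  exact: (Quotient.idealrBE rel_zmod).
by rewrite e; split=> /eqP.
Qed.

Definition quot_repr (u : quotient) : M := repr (u : Quotient.quot rel_zmod).
Lemma quot_reprK u : quot_pi (quot_repr u) = u.
Proof. exact: reprK. Qed.

Lemma quot_piD : {morph quot_pi : x y / x + y}.
Proof. by move=> x y; rewrite /quot_pi raddfD. Qed.

Definition quot_scale a (u : quotient) := quot_pi (a *: quot_repr u).
Lemma quot_piZ a x : quot_scale a (quot_pi x) = quot_pi (a *: x).
Proof.
apply/quot_piP; rewrite -scalerBr.
have [K0 Kl] := K_submod.
have /quot_piP : quot_pi (quot_repr (quot_pi x)) = quot_pi x by apply: quot_reprK.
by move=> /(Kl a _ _)/(_ K0); rewrite addr0.
Qed.

Fact quot_scaleA a b u : quot_scale a (quot_scale b u) = quot_scale (a * b) u.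
Proof. by rewrite -[u]quot_reprK !quot_piZ scalerA. Qed.
Fact quot_scale1 : left_id 1 quot_scale.
Proof. by move=> u; rewrite -[u]quot_reprK quot_piZ scale1r. Qed.
Fact quot_scaleDr : right_distributive quot_scale +%R.
Proof.
move=> a u v; rewrite -[u]quot_reprK -[v]quot_reprK.
by rewrite -quot_piD !quot_piZ scalerDr quot_piD.
Qed.
Fact quot_scaleDl u : {morph quot_scale^~ u : a b / a + b}.
Proof.
by move=> a b; rewrite -[u]quot_reprK !quot_piZ scalerDl quot_piD.
Qed.

HB.instance Definition _ := GRing.Zmodule_isLmodule.Build R quotient
  quot_scaleA quot_scale1 quot_scaleDr quot_scaleDl.

Fact quot_pi_linear : linear quot_pi.
Proof. by move=> a x y; rewrite quot_piD -quot_piZ. Qed.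
HB.instance Definition _ :=
  GRing.isLinear.Build R M quotient *:%R quot_pi quot_pi_linear.

End Quotient.

(** The first isomorphism theorem. *)
Lemma image_factorization (R : pzRingType) (M N : lmodType R)
    (f : {linear M -> N}) :
  exists (K : {pred M}) (K_submod : submod_closed K)
    (j : {linear quotient K_submod -> N}),
    injective j /\ forall x, j (quot_pi K_submod x) = f x.
Proof.
pose K : {pred M} := [pred x | f x == 0].
have K_submod : submod_closed K.
  split=> [|a x y]; rewrite !inE ?linear0 // => /eqP fx /eqP fy.
  by rewrite linearP fx fy scaler0 addr0.
exists K, K_submod.
pose j (u : quotient K_submod) := f (quot_repr u).
have jE x : j (quot_pi K_submod x) = f x.
  apply/eqP; rewrite -subr_eq0 -linearB -[_ == 0]/(_ \in K).
  by apply/(quot_piP K_submod); rewrite quot_reprK.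
have j_lin : linear j.
  move=> a u v; rewrite -[u]quot_reprK -[v]quot_reprK.
  by rewrite -linearP !jE linearP.
pose jL := GRing.isLinear.Build R _ N *:%R j j_lin.
exists (HB.pack_for {linear quotient K_submod -> N} j jL); split; last exact: jE.
move=> u v /= /eqP; rewrite -subr_eq0 -linearB -[_ == 0]/(_ \in K) => Kuv.
by rewrite -[u]quot_reprK -[v]quot_reprK; apply/quot_piP.
Qed.

(** * Finiteness over noetherian rings *)

Section Noetherian.
Variable R : comPzRingType.
Implicit Types M N : lmodType R.

Lemma fin_pres_gen M : fin_pres M -> fin_gen M.
Proof. by move=> [m [n [q [p [p_surj _]]]]]; exists n, p. Qed.

Lemma fin_pres_free n : fin_pres 'rV[R]_n.
Proof.
exists 0%N, n, \0, idfun; split; first by move=> x _; exists x.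
by apply/seteqP; split=> x /= => [->|[y _ <-]//]; exists 0.
Qed.

(** By induction on [n]: the first coordinates of the elements of [K] form an
    ideal, and the elements whose first coordinate is zero form a submodule of
    a free module of smaller rank. *)
Lemma noetherian_submodule n (K : set 'rV[R]_n) : noetherian R ->
  K 0 -> (forall a x y, K x -> K y -> K (a *: x + y)) ->
  exists (m : nat) (B : 'M[R]_(m, n)), K = range (mulmxr B : 'rV_m -> 'rV_n).
Proof.
move=> R_noeth; elim: n K => [|n IHn] K K0 Kl.
  exists 0%N, 0; apply/seteqP; split=> x /= _; last by rewrite (thinmx0 x).
  by exists 0 => //; rewrite (thinmx0 x) mul0mx.
have KD x y : K x -> K y -> K (x + y).
  by move=> Kx; rewrite -[x]scale1r; apply: Kl.
have Ksum m (u : 'rV_m) (B : 'M_(m, n.+1)) : (forall i, K (row i B)) ->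
    K (u *m B).
  move=> KB; rewrite mulmx_sum_row; elim/big_ind: _ => //.
  by move=> i _; rewrite -[_ *: _]addr0; apply: Kl.
pose J := [set a : R | exists w : 'rV_n, K (row_mx a%:M w)].
have [k [g gP]] : exists (k : nat) (g : 'I_k -> R),
    J = [set x | exists c : 'I_k -> R, x = \sum_i c i * g i].
  apply: R_noeth; split=> [|a x y [v Kv] [w Kw]].
    by exists 0; rewrite raddf0 row_mx0.
  exists (a *: v + w); rewrite raddfD /= -scale_scalar_mx -add_row_mx.
  by rewrite -scale_row_mx; apply: Kl.
have /choice[w wP] (i : 'I_k) : exists w : 'rV_n, K (row_mx (g i)%:M w).
  suff : J (g i) by []. rewrite gP; exists (fun j => (i == j)%:R).
  rewrite (bigD1 i) //= eqxx mul1r big1 ?addr0 // => j; rewrite eq_sym.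
  by move=> /negPf->; rewrite mul0r.
(* The rows of [V] lift generators of the ideal [J]; those of [B] generate the
   elements with first coordinate zero. *)
pose V : 'M_(k, 1 + n) := \matrix_i row_mx (g i)%:M (w i).
have KV (c : 'rV_k) : K (c *m V) by apply: Ksum => i; rewrite rowK.
have [|a x y Kx Ky|m [B BP]] := IHn [set w | K (row_mx (0 : 'rV_1) w)].
- by rewrite /= row_mx0.
- have -> : 0 = a *: 0 + 0 :> 'rV_1 by rewrite scaler0 addr0.
  by rewrite /= -add_row_mx -scale_row_mx; apply: Kl.
have KB (u : 'rV_m) : K (u *m row_mx (0 : 'M_(m, 1)) B).
  rewrite mul_mx_row mulmx0.
  by suff : [set w | K (row_mx (0 : 'rV_1) w)] (u *m B) by []; rewrite BP; exists u.
exists (k + m)%N, (col_mx V (row_mx 0 B)); apply/seteqP; split=> x; last first.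
  by move=> [u _ <-] /=; rewrite -[u]hsubmxK mul_row_col; apply: KD.
move=> Kx; pose a : R := lsubmx (x : 'rV_(1 + n)) 0 0.
have xE : x = row_mx a%:M (rsubmx (x : 'rV_(1 + n))).
  by rewrite -[LHS](hsubmxK (x : 'rV_(1 + n))) [lsubmx _]mx11_scalar.
have : J a by exists (rsubmx (x : 'rV_(1 + n))); rewrite -xE.
rewrite gP => -[c cP]; pose c' := \row_i c i.
have c'V : c' *m V = row_mx a%:M (\sum_i c i *: w i).
  rewrite mulmx_sum_row cP raddf_sum /=.
  under eq_bigr => i _ do rewrite rowK mxE scale_row_mx scale_scalar_mx.
  apply/rowP=> i; rewrite summxE; case: (split_ordP i) => j ->.
    by rewrite row_mxEl summxE; apply: eq_bigr => l _; rewrite row_mxEl.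
  by rewrite row_mxEr summxE; apply: eq_bigr => l _; rewrite row_mxEr.
have : [set w | K (row_mx (0 : 'rV_1) w)]
    (rsubmx (x : 'rV_(1 + n)) - \sum_i c i *: w i).
  have -> : 0 = a%:M - a%:M :> 'M_1 by rewrite subrr.
  rewrite /= -add_row_mx -opp_row_mx -xE -c'V.
  by rewrite addrC -scaleN1r; apply: Kl.
rewrite BP => -[u _ uB]; exists (row_mx c' u) => //=.
rewrite mul_row_col c'V (mul_mx_row u (0 : 'M_(m, 1)) B) [u *m B]uB mulmx0.
by rewrite (@add_row_mx _ 1 1 n) [RHS]xE addr0 addrC subrK.
Qed.

Lemma fin_gen_pres M : noetherian R -> fin_gen M -> fin_pres M.
Proof.
move=> R_noeth [n [p p_surj]].
have [|a x y px py|m [B BP]] := @noetherian_submodule n [set x | p x = 0] R_noeth.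
- exact: linear0.
- by rewrite /= linearP px py scaler0 addr0.
by exists m, n, (mulmxr B), p.
Qed.

End Noetherian.

(** * Additive closures *)

Section AddClosure.
Variable R : comPzRingType.
Implicit Types (M N : lmodType R) (A : lmodType R -> Prop).

(** A retract is a direct summand: if [p] is a retraction of [i], then the image
    of [1 - i p] is a complement of [M]. *)
Lemma AddP A M :
  Add A M <-> exists (I : choiceType) (V : I -> lmodType R),
    (forall i, A (V i)) /\
    exists (i : {linear M -> lsum V}) (p : {linear lsum V -> M}), cancel i p.
Proof.
split=> -[I [V [AV]]].
  move=> [N [f f_bij]]; exists I, V; split=> //.
  have [g [fK gK]] := linear_inv f_bij.
  pose i x := f (x, 0).
  have i_lin : linear i.
    by move=> a x y; rewrite /i -linearP; congr (f (_, _)); rewrite /= scaler0 addr0.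
  pose p u := (g u).1.
  have p_lin : linear p by move=> a x y; rewrite /p linearP.
  exists (HB.pack_for {linear M -> lsum V} i (GRing.isLinear.Build R _ _ _ i i_lin)).
  exists (HB.pack_for {linear lsum V -> M} p (GRing.isLinear.Build R _ _ _ p p_lin)).
  by move=> x; rewrite /= /p /i fK.
move=> [i [p iK]]; exists I, V; split=> //.
have [K [K_submod [j [j_inj jE]]]] := image_factorization (idfun \- (i \o p)).
have {}jE u : j (quot_pi K_submod u) = u - i (p u) by rewrite jE.
have pj q : p (j q) = 0.
  by rewrite -[q]quot_reprK jE linearB iK subrr.
pose f (x : M * quotient K_submod) := i x.1 + j x.2.
have f_lin : linear f.
  by move=> a x y; rewrite /f /= !linearP scalerDr addrACA.
exists (quotient K_submod).
exists (HB.pack_for {linear (M * quotient K_submod)%type -> lsum V} f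
  (GRing.isLinear.Build R _ _ _ f f_lin)).
exists (fun u => (p u, quot_pi K_submod u)) => [[x q]|u]; rewrite /= /f /=.
  rewrite linearD iK pj addr0; congr (_, _); apply: j_inj.
  by rewrite jE linearD iK pj addr0 addrAC subrr add0r.
by rewrite jE addrC subrK.
Qed.

Lemma Add_gen A M : A M -> Add A M.
Proof.
move=> AM; apply/AddP; exists unit, (fun=> M); split=> //.
exists (lsum_inj (fun=> M) tt), (lsum_proj (fun=> M) tt) => x.
by rewrite lsum_projE lsum_injE (@delta_id _ _ (fun=> M)).
Qed.

Lemma Add_zero A : Add A 'rV[R]_0.
Proof.
apply/AddP; exists void, (fun=> 'rV[R]_0); split=> [[]|].
by exists \0, \0 => x; rewrite [x]thinmx0.
Qed.

Lemma Add_mono A B M : (forall N, A N -> B N) -> Add A M -> Add B M.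
Proof. by move=> AB [I [V [AV f]]]; exists I, V; split=> // i; apply: AB. Qed.

(** A direct sum of retracts of direct sums is a retract of the direct sum over
    all pairs of indices. *)
Lemma Add_lsum A (I : choiceType) (V : I -> lmodType R) :
  (forall i, Add A (V i)) -> Add A (lsum V).
Proof.
move=> AV.
have /choice[J /dep_choice[Wi WP]] i : exists J : choiceType,
    exists W : J -> lmodType R, (forall j, A (W j)) /\
    exists (u : {linear V i -> lsum W}) (p : {linear lsum W -> V i}), cancel u p.
  by move/AddP: (AV i).
have /all_and2[AW /dep_choice[u /dep_choice[p pK]]] := WP.
pose W (ij : {i : I & J i}) := Wi (tag ij) (tagged ij).
pose t i : {linear lsum (Wi i) -> lsum W} :=
  @copair _ _ (Wi i) _ (fun j => lsum_inj W (Tagged J j)).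
pose q : {linear lsum W -> lsum V} := @copair _ _ W _ (fun ij =>
  lsum_inj V (tag ij) \o p (tag ij) \o lsum_inj (Wi (tag ij)) (tagged ij)).
apply/AddP; exists {i : I & J i}, W; split; first by move=> ij; apply: AW.
exists (copair (fun i => t i \o u i)), q.
apply: (@lsum_ext _ _ _ _ (q \o copair (fun i => t i \o u i)) idfun) => i x /=.
rewrite copair_inj /=.
have qt y : q (t i y) = lsum_inj V i (p i y).
  apply: (@lsum_ext _ _ _ _ (q \o t i) (lsum_inj V i \o p i)) => j z /=.
  by rewrite copair_inj [LHS](copair_inj _ (_ : W (Tagged J j))).
by rewrite qt pK.
Qed.

End AddClosure.

Section TorsionFree.
Variables (R : comPzRingType) (S : set R).
Hypothesis S1 : S 1.
Implicit Types M N : lmodType R.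

Lemma torsion_freeP M :
  torsion_free S M <-> forall s (x : M), S s -> s *: x = 0 -> x = 0.
Proof.
split=> [M_tf s x Ss sx|M_tf].
  by have : @torsion R S M x by [exists s]; rewrite M_tf.
apply/seteqP; split=> x /=; first by move=> [s Ss sx]; apply: M_tf sx.
by move=> ->; exists 1; rewrite ?scaler0.
Qed.

Lemma torsion_free_inj M N (f : {linear N -> M}) :
  injective f -> torsion_free S M -> torsion_free S N.
Proof.
move=> f_inj /torsion_freeP M_tf; apply/torsion_freeP => s x Ss sx.
by apply: f_inj; rewrite linear0; apply: (M_tf s) => //; rewrite -linearZ_LR sx linear0.
Qed.

Lemma torsion_free_Add A M : (forall N, A N -> torsion_free S N) ->
  Add A M -> torsion_free S M.
Proof.
move=> A_tf /AddP[I [V [AV [i [p iK]]]]].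
apply: (torsion_free_inj (can_inj iK)); apply/torsion_freeP => s x Ss sx.
apply: dsumP => j; have /torsion_freeP := A_tf _ (AV j); apply; first exact: Ss.
by rewrite -[LHS]/((s *: x : lsum V) j) sx.
Qed.

End TorsionFree.

(** * Pure exactness and pure projectivity *)

Section Pure.
Variable R : comPzRingType.
Implicit Types L M N P Q : lmodType R.

(** Homomorphisms from the free module of rank one are elements. *)
Lemma pure_exactP L M P (f : {linear L -> M}) (g : {linear M -> P}) :
  pure_exact f g -> forall y, g y = 0 <-> exists x, y = f x.
Proof.
move=> fg y; pose h (r : 'rV[R]_1) := r 0 0 *: y.
have h_lin : linear h by move=> a r t; rewrite /h !mxE scalerDl scalerA.
have [hf fh] := fg _ (fin_pres_free R 1)
  (HB.pack_for {linear 'rV[R]_1 -> M} h (GRing.isLinear.Build R _ _ _ h h_lin)).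
have h1 : h 1%:M = y by rewrite /h mxE scale1r.
split=> [gy|[x yE]].
  have [|k kP] := hf; first by move=> r; rewrite /= linearZ_LR gy scaler0.
  by exists (k 1%:M); rewrite -kP.
rewrite -h1; apply: fh; pose k (r : 'rV[R]_1) := r 0 0 *: x.
have k_lin : linear k by move=> a r t; rewrite /k !mxE scalerDl scalerA.
exists (HB.pack_for {linear 'rV[R]_1 -> L} k (GRing.isLinear.Build R _ _ _ k k_lin)).
by move=> r; rewrite /= /h /k linearZ_LR yE.
Qed.

Lemma pure_exact_comp0 L M P (f : {linear L -> M}) (g : {linear M -> P}) x :
  pure_exact f g -> g (f x) = 0.
Proof. by move=> /pure_exactP fg; apply/fg; exists x. Qed.

Lemma pure_lift N L M P (f : {linear L -> M}) (g : {linear M -> P})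
    (h : {linear N -> M}) :
  pure_projective N -> pure_exact f g -> (forall x, g (h x) = 0) ->
  exists k : {linear N -> L}, forall x, f (k x) = h x.
Proof.
by move=> N_pp fg gh; have [/(_ gh)[k kP] _] := N_pp _ _ _ _ _ fg h; exists k.
Qed.

(** Lifts from the summands assemble to a lift from the direct sum, which
    restricts to its retracts. *)
Lemma pure_projective_Add A M : (forall N, A N -> fin_pres N) ->
  Add A M -> pure_projective M.
Proof.
move=> A_fp /AddP[I [V [AV [i [p iK]]]]] L M' P f g fg h.
split=> [gh|[k kP] x]; last by rewrite kP (pure_exact_comp0 _ fg).
have /dep_choice[k kP] j : exists k : {linear V j -> L},
    forall x, f (k x) = h (p (lsum_inj V j x)).
  have [] := fg _ (A_fp _ (AV j)) (h \o p \o lsum_inj V j).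
  by case=> [x|k kP _]; [apply: gh | exists k => x; rewrite -kP].
exists (copair k \o i) => x; rewrite -{1}[x]iK.
apply/esym/(@lsum_ext _ _ _ _ (f \o copair k) (h \o p)) => j y /=.
by rewrite copair_inj.
Qed.

(** * Splitting of long pure resolutions *)

(** Two successive degrees of a comparison of complexes [Y] and [P]: maps [a]
    from [Y] to [P], maps [b] back, and a homotopy [s] from [b a] to the identity.
    The homotopy identity is required on the image of [g] only. There the term
    that involves the next lower differential vanishes, so that nothing below
    these two degrees has to be remembered in order to continue upwards. *)
Definition comparison (Y1 Y0 P1 P0 : lmodType R)
    (g : {linear Y1 -> Y0}) (f : {linear P1 -> P0}) :=
  exists (a1 : {linear Y1 -> P1}) (a0 : {linear Y0 -> P0})
    (b1 : {linear P1 -> Y1}) (b0 : {linear P0 -> Y0}) (s : {linear Y0 -> Y1}),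
  [/\ forall y, f (a1 y) = a0 (g y), forall x, g (b1 x) = b0 (f x)
    & forall y, g y = b0 (a0 (g y)) + g (s (g y))].

(** The comparison starts with the identity of the resolved module. *)
Lemma comparison_base (Y0 P0 N O : lmodType R)
    (g : {linear Y0 -> N}) (f : {linear P0 -> N}) (z : {linear N -> O}) :
  pure_projective Y0 -> pure_projective P0 ->
  pure_exact g z -> pure_exact f z -> comparison g f.
Proof.
move=> Y0_pp P0_pp gz fz.
have [a aP] := pure_lift (h := g) Y0_pp fz (fun y => pure_exact_comp0 y gz).
have [b bP] := pure_lift (h := f) P0_pp gz (fun x => pure_exact_comp0 x fz).
by exists a, idfun, b, idfun, \0; split=> // y; rewrite /= linear0 addr0.
Qed.

(** In the next degree, [a] and [b] are lifts of their composites with the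
    differentials, and the homotopy is a lift of [1 - b a - s g]. *)
Lemma comparison_step (Y2 Y1 Y0 P2 P1 P0 : lmodType R)
    (g' : {linear Y2 -> Y1}) (g : {linear Y1 -> Y0})
    (f' : {linear P2 -> P1}) (f : {linear P1 -> P0}) :
  pure_projective Y2 -> pure_projective Y1 -> pure_projective P2 ->
  pure_exact g' g -> pure_exact f' f -> comparison g f -> comparison g' f'.
Proof.
move=> Y2_pp Y1_pp P2_pp gg ff [a1 [a0 [b1 [b0 [s [fa gb sP]]]]]].
have [|a2 a2P] := pure_lift (h := a1 \o g') Y2_pp ff.
  by move=> y; rewrite /= fa (pure_exact_comp0 _ gg) linear0.
have [|b2 b2P] := pure_lift (h := b1 \o f') P2_pp gg.
  by move=> x; rewrite /= gb (pure_exact_comp0 _ ff) linear0.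
have [|t tP] := pure_lift (h := (idfun \- (b1 \o a1)) \- (s \o g)) Y1_pp gg.
  by move=> y; rewrite /= !linearB gb fa /= {1}sP addrAC addrK subrr.
exists a2, a1, b2, b1, t; split=> // y.
rewrite tP /= (pure_exact_comp0 _ gg) linear0 subr0.
by rewrite addrC subrK.
Qed.

(** Compare the resolution [Y] with one of length [d]. The latter vanishes in
    degree [d + 1], so [b a] is zero on the image of [g d], and what remains of
    the homotopy identity there is that [s] splits [g d]. *)
Lemma resolution_splits d (Y : nat -> lmodType R) N
    (g : forall n, {linear Y n.+1 -> Y n}) (e : {linear Y 0%N -> N}) :
  pure_gldim_le R d -> (forall n, pure_projective (Y n)) ->
  (forall n, pure_exact (g n.+1) (g n)) -> pure_exact (g 0%N) e ->
  pure_exact e (\0 : {linear N -> 'rV[R]_0}) ->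
  exists s : {linear Y d -> Y d.+1}, forall y, g d (s (g d y)) = g d y.
Proof.
move=> R_d Y_pp gg ge e0; have [P [f [e' [P_pp P0 ff fe e'0]]]] := R_d N.
have cmp n : comparison (g n) (f n).
  elim: n => [|n IHn]; last exact: (comparison_step _ _ _ (gg n) (ff n) IHn).
  have cmp_e : comparison e e' by exact: (comparison_base _ _ e0 e'0).
  exact: (comparison_step _ _ _ ge fe cmp_e).
have [a1 [a0 [b1 [b0 [s [fa _ sP]]]]]] := cmp d.
by exists s => y; rewrite [RHS]sP -fa (P0 _ (ltnSn d) (a1 y)) !linear0 add0r.
Qed.

End Pure.

(** * Contractibility of pure exact complexes *)

Section Contraction.
Variables (R : comPzRingType) (A : lmodType R -> Prop).
Implicit Type X : complex A.

(** The integer [n + k], in a form such that [up n k.+1] is convertible to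
    [up n k + 1], the degree in which a differential with values in degree
    [up n k] starts. *)
Fixpoint up (n : int) (k : nat) : int := if k is k'.+1 then up n k' + 1 else n.

Lemma upE n k : up n k = n + k%:Z.
Proof. by elim: k => [|k IHk] /=; rewrite ?addr0 // IHk -addrA intS [1 + _]addrC. Qed.

(** Every integer is a successor, so a family can be given by its values at
    successors, where differentials are defined. *)
Lemma shift_family (T : int -> Type) (F : forall n, T (n + 1)) :
  exists G : forall m, T m, forall n, G (n + 1) = F n.
Proof.
exists (fun m => ecast k (T k) (subrK 1 m) (F (m - 1))) => n.
have F_cast n' : n' = n -> forall e : n' + 1 = n + 1,
    ecast k (T k) e (F n') = F n.
  by move=> -> e; rewrite eq_axiomK.
exact/F_cast/addrK.
Qed.

(** The contraction is [s (1 - s d)]: the factor [1 - s d] takes values in the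
    cycles, which are boundaries, and [d s] is the identity on boundaries. *)
Lemma split_contractible X :
  (forall (n : int) x, diff X n x = 0 -> exists y, x = diff X (n + 1) y) ->
  (forall n, exists s : {linear X n -> X (n + 1)},
     forall x, diff X n (s (diff X n x)) = diff X n x) ->
  null_homotopic (chmap1 X).
Proof.
move=> X_exact /dep_choice[s sP].
have [t tP] := @shift_family (fun n => {linear X n -> X (n + 1)})
  (fun n => s (n + 1) \o (idfun \- (s n \o diff X n))).
exists t => n; rewrite -[n](subrK 1); move: (n - 1) => {}n x.
rewrite !tP /= diffK linear0 subr0.
set y := x - _; have [|z yE] := X_exact (n + 1) y.
  by rewrite /y linearB sP subrr.
by rewrite yE sP -yE /y subrK.
Qed.

(** The image of a differential is resolved by the terms above it. To split the
    differential into degree [n], use the resolution that starts [d] degrees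
    below [n]. *)
Lemma pure_exact_contractible d X :
  pure_gldim_le R d -> (forall n, pure_projective (X n)) ->
  (forall n : int, pure_exact (diff X (n + 1)) (diff X n)) ->
  null_homotopic (chmap1 X).
Proof.
move=> R_d X_pp X_pure.
apply: split_contractible => [n x|n]; first by move/(pure_exactP (X_pure n)).
have -> : n = up (n - d%:Z - 1 - 1 + 1 + 1) d by rewrite upE !subrK.
move: (n - _ - 1 - 1) => {}n.
have [K [K_submod [j [j_inj jE]]]] := image_factorization (diff X (n + 1)).
pose Y k := X (up (n + 1 + 1) k).
pose g k : {linear Y k.+1 -> Y k} := diff X (up (n + 1 + 1) k).
apply: (@resolution_splits R d Y _ g (quot_pi K_submod)) => //.
- by move=> k; apply: X_pp.
- by move=> k; apply: X_pure.
- move=> N N_fp h; have [hg gh] := X_pure (n + 1) N N_fp h.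
  split=> [pih|/gh dh x]; first by apply: hg => x; rewrite -jE pih linear0.
  by apply: j_inj; rewrite jE dh linear0.
move=> N N_fp h; split=> // _.
have [] := X_pure n N N_fp (j \o h).
case=> [x|k kP _]; first by rewrite /= -[h x]quot_reprK jE diffK.
by exists k => x; apply: j_inj; rewrite jE -kP.
Qed.

End Contraction.

(** * Coproducts and compact objects in preadditive categories *)

Section Preadditive.
Variable T : preadditive.

Lemma comp0l (X Y Z : T) (f : hom X Y) : comp (0 : hom Y Z) f = 0.
Proof. by apply: (addrI (comp 0 f)); rewrite -compDl !addr0. Qed.

Lemma comp0r (X Y Z : T) (g : hom Y Z) : comp g (0 : hom X Y) = 0.
Proof. by apply: (addrI (comp g 0)); rewrite -compDr !addr0. Qed.

Lemma comp_sumr (X Y Z : T) (g : hom Y Z) (I : Type) (r : seq I)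
    (F : I -> hom X Y) :
  comp g (\sum_(i <- r) F i) = \sum_(i <- r) comp g (F i).
Proof. exact: (big_morph _ (compDr g) (comp0r X g)). Qed.

Lemma hom_coprodE (C : T) (I : choiceType) (X : I -> T) (D : T)
    (inj : forall i, hom (X i) D) (phi : dsum (fun i => hom C (X i))) r :
  uniq r -> (forall i, phi i != 0 -> i \in r) ->
  hom_coprod inj phi = \sum_(i <- r) comp (inj i) (phi i).
Proof.
move=> r_uniq phir; rewrite /hom_coprod (fsbigE r) //.
  by apply: eq_bigl => i; rewrite in_setT.
move=> i _; apply: contraNeq => i0; apply: phir.
by apply: contra_neq i0 => ->; rewrite comp0r.
Qed.

Lemma comp_hom_coprod (C : T) (I : choiceType) (X : I -> T) (D E : T)
    (inj : forall i, hom (X i) D) (g : hom D E) phi :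
  comp g (hom_coprod inj phi) =
  hom_coprod (C := C) (fun i => comp g (inj i)) phi.
Proof.
have [r r_uniq phir] := dsum_supp phi.
rewrite !(hom_coprodE _ r_uniq phir) comp_sumr.
by apply: eq_bigr => i _; rewrite compA.
Qed.

(** The projections of a coproduct onto its summands recover the components of
    a morphism in the image of the canonical map; they exist by the universal
    property. *)
Lemma hom_coprod_inj (C : T) (I : choiceType) (X : I -> T) (D : T)
    (inj : forall i, hom (X i) D) :
  is_coproduct inj -> injective (@hom_coprod T C I X D inj).
Proof.
move=> D_coprod phi psi eq_hom; apply: dsumP => j.
pose d i : hom (X i) (X j) :=
  if @eqP _ i j is ReflectT e then ecast k (hom (X i) (X k)) e (idm (X i)) else 0.
have dj : d j = idm (X j) by rewrite /d; case: eqP => // e; rewrite eq_axiomK.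
have dne i : i != j -> d i = 0 by rewrite /d; case: eqP.
have [p [pP _]] := D_coprod _ d.
have p_hom chi : comp p (hom_coprod inj chi) = chi j :> hom C (X j).
  have [r r_uniq chir] := dsum_supp chi.
  rewrite (hom_coprodE _ r_uniq chir) comp_sumr.
  under eq_bigr => i _ do rewrite compA pP.
  have [jr|jr] := boolP (j \in r).
    rewrite (bigD1_seq j) //= dj comp1m big1 ?addr0 // => i ij.
    by rewrite dne // comp0l.
  have -> : chi j = 0 by apply: contraNeq jr; apply: chir.
  rewrite big_seq big1 // => i ir; rewrite dne ?comp0l //.
  by apply: contraNneq jr => <-.
by rewrite -!p_hom eq_hom.
Qed.

(** Coproducts of the same family are isomorphic, so surjectivity of the
    canonical map can be tested on one of them; injectivity always holds. *)
Lemma compact_chosen (C : T) :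
  (forall (I : choiceType) (X : I -> T),
    exists (D : T) (inj : forall i, hom (X i) D), is_coproduct inj /\
      forall f : hom C D, exists phi, hom_coprod inj phi = f) ->
  compact C.
Proof.
move=> C_chosen I X D inj D_coprod.
have [D' [inj' [D'_coprod surj']]] := C_chosen I X.
have [t [tP _]] := D_coprod _ inj'; have [t' [t'P _]] := D'_coprod _ inj.
have tt' : comp t' t = idm D.
  have [u [_ u_uniq]] := D_coprod _ inj.
  rewrite -(u_uniq (comp t' t)) ?(u_uniq (idm D)) // => i.
    by rewrite comp1m.
  by rewrite -compA tP t'P.
have /choice[g gP] : forall f : hom C D, exists phi, hom_coprod inj phi = f.
  move=> f; have [phi phiP] := surj' (comp t f); exists phi.
  have -> : inj = fun i => comp t' (inj' i).
    by apply: functional_extensionality_dep => i; rewrite t'P.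
  by rewrite -comp_hom_coprod phiP compA tt' comp1m.
exists g => // phi; exact/(hom_coprod_inj D_coprod)/gP.
Qed.

End Preadditive.

(** * Coproducts of complexes *)

Arguments chmap {R A} X Y.
Arguments ChMap {R A X Y} chm _ _.
Arguments chm {R A X Y} c n x.
Arguments chm_diff {R A X Y} c n x.

Section Coproducts.
Variables (R : comPzRingType) (A : lmodType R -> Prop).
Variables (I : choiceType) (X : I -> complex (Add A)).
Implicit Types Y Z : complex (Add A).

Definition sum_diff (n : int) :
    {linear lsum (fun i => X i (n + 1)) -> lsum (fun i => X i n)} :=
  @copair _ _ (fun i => X i (n + 1)) _
    (fun i => lsum_inj (fun i => X i n) i \o diff (X i) n).

Lemma sum_diffE (n : int) u i : sum_diff n u i = diff (X i) n (u i).
Proof.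
pose p m : {linear lsum (fun i => X i m) -> X i m} :=
  lsum_proj (fun i => X i m) i.
apply: (@lsum_ext _ _ _ _ (p n \o sum_diff n) (diff (X i) n \o p (n + 1))).
move=> j x /=; rewrite copair_inj /= !lsum_projE !lsum_injE.
have [<-|ji] := eqVneq j i; first by rewrite !delta_id.
by rewrite !delta_ne // linear0.
Qed.

Fact sum_diffK (n : int) u : sum_diff n (sum_diff (n + 1) u) = 0.
Proof. by apply: dsumP => i; rewrite !sum_diffE diffK. Qed.

Definition sum_complex : complex (Add A) :=
  Complex (fun n => Add_lsum (fun i => ch_in (X i) n)) sum_diffK.

Fact sum_inj_diff i (n : int) (x : X i (n + 1)) :
  lsum_inj (fun i => X i n) i (diff (X i) n x) =
  sum_diff n (lsum_inj (fun i => X i (n + 1)) i x).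
Proof. by rewrite /sum_diff copair_inj. Qed.

Definition sum_inj i : chmap (X i) sum_complex :=
  @ChMap _ _ (X i) sum_complex (fun n => lsum_inj (fun i => X i n) i)
    (fun n => linearP (lsum_inj (fun i => X i n) i))
    (@sum_inj_diff i).

Fact sum_proj_diff i (n : int) (u : sum_complex (n + 1)) :
  lsum_proj (fun i => X i n) i (sum_diff n u) =
  diff (X i) n (lsum_proj (fun i => X i (n + 1)) i u).
Proof. by rewrite !lsum_projE sum_diffE. Qed.

Definition sum_proj i : chmap sum_complex (X i) :=
  @ChMap _ _ sum_complex (X i) (fun n => lsum_proj (fun i => X i n) i)
    (fun n => linearP (lsum_proj (fun i => X i n) i))
    (@sum_proj_diff i).

Section Copairing.
Variables (Y : complex (Add A)) (g : forall i, chmap (X i) Y).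

Definition sum_copair_at n : {linear lsum (fun i => X i n) -> Y n} :=
  @copair _ _ (fun i => X i n) (Y n) (fun i => g i n).

Lemma sum_copair_inj n i x :
  sum_copair_at n (lsum_inj (fun i => X i n) i x) = g i n x.
Proof. exact: (@copair_inj _ _ (fun i => X i n)). Qed.

Fact sum_copair_diff (n : int) u :
  sum_copair_at n (diff sum_complex n u) = diff Y n (sum_copair_at (n + 1) u).
Proof.
apply: (@lsum_ext _ _ _ _ (sum_copair_at n \o sum_diff n)
  (diff Y n \o sum_copair_at (n + 1))) => i x /=.
by rewrite -sum_inj_diff !sum_copair_inj chm_diff.
Qed.

Definition sum_copair : chmap sum_complex Y :=
  @ChMap _ _ sum_complex Y sum_copair_at
    (fun n => linearP (sum_copair_at n)) sum_copair_diff.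

End Copairing.

(** Homotopies on the summands assemble, which gives the uniqueness part of the
    universal property up to homotopy. *)
Lemma sum_null_homotopic Y (f : chmap sum_complex Y) :
  (forall i, null_homotopic (chmap_comp f (sum_inj i))) -> null_homotopic f.
Proof.
move=> /dep_choice[s sP]; pose t n : {linear lsum (fun i => X i n) -> Y (n + 1)} :=
  @copair _ _ (fun i => X i n) (Y (n + 1)) (fun i => s i n).
exists t => n.
pose h : {linear lsum (fun i => X i (n + 1)) -> Y (n + 1)} :=
  (diff Y (n + 1) \o t (n + 1)) \+ (t n \o sum_diff n).
suff : forall u, f (n + 1) u = h u by [].
pose f' : {linear sum_complex (n + 1) -> Y (n + 1)} := f (n + 1).
apply: (@lsum_ext _ _ (fun i => X i (n + 1)) (Y (n + 1)) f' h).
move=> i x; rewrite /= -sum_inj_diff.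
have tP m y : t m (lsum_inj (fun i => X i m) i y) = s i m y.
  exact: (@copair_inj _ _ (fun i => X i m)).
by rewrite !tP -sP.
Qed.

Lemma sum_complex_coproduct :
  @is_coproduct (K (Add A)) I X sum_complex (fun i => class (sum_inj i)).
Proof.
move=> Y g; exists (class (sum_copair (fun i => rep (g i)))); split.
  move=> i; rewrite -[RHS]repK; apply: etrans (class_comp _ _) _.
  by congr class; apply: chmapP => n x /=; rewrite sum_copair_inj.
move=> f fP; rewrite -[f]repK; apply/classP/sum_null_homotopic => i.
have /classP : class (rep (g i)) = class (chmap_comp (rep f) (sum_inj i)).
  by rewrite -class_comp !repK; apply: esym (fP i).
congr null_homotopic; apply: chmapP => n x /=.
by rewrite sum_copair_inj.
Qed.

End Coproducts.

(** * Complexes concentrated in one degree *)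

Section Concentrated.
Variables (R : comPzRingType) (A : lmodType R -> Prop).
Implicit Types (C X Y : complex (Add A)) (M : lmodType R).

Definition concentrated C (n : int) := forall k (x : C k), k != n -> x = 0.

Lemma concentrated_diff C n k (x : C (k + 1)) :
  concentrated C n -> diff C k x = 0.
Proof.
move=> Cn; have [kn|] := eqVneq k n; last exact: Cn.
rewrite (Cn (k + 1) x) ?linear0 // kn.
by rewrite -[X in _ != X]addr0 (inj_eq (addrI _)).
Qed.

Lemma concentrated_eq C n X (f g : chmap C X) :
  concentrated C n -> (forall x, f n x = g n x) -> f = g.
Proof.
move=> Cn fg; apply: chmapP => k x.
have [kn|kn] := eqVneq k n; first by move: x; rewrite kn.
by rewrite (Cn k x kn) !linear0.
Qed.

Definition stalk_at M (n k : int) : lmodType R := if k == n then M else 'rV_0.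

Fact stalk_in M n k : Add A M -> Add A (stalk_at M n k).
Proof. by move=> AM; rewrite /stalk_at; case: eqP => // _; apply: Add_zero. Qed.

Definition stalk M (AM : Add A M) (n : int) : complex (Add A) :=
  Complex (diff := fun k => \0) (fun k => stalk_in n k AM)
    (fun k x => erefl (0 : stalk_at M n k)).

Lemma stalk_concentrated M (AM : Add A M) n : concentrated (stalk AM n) n.
Proof.
by move=> k x /negPf kn; move: x; rewrite /= /stalk_at kn => x; apply: thinmx0.
Qed.

Lemma stalk_iso M (AM : Add A M) n :
  exists (i : {linear M -> stalk AM n n}) (j : {linear stalk AM n n -> M}),
    cancel i j /\ cancel j i.
Proof.
rewrite /= /stalk_at; case: eqP => // _.
by exists idfun, idfun.
Qed.

(** Out of a complex concentrated in degree [n + 1], a chain map is a cycle of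
    the complex of homomorphisms, and a homotopy is a single map, which exhibits
    it as a boundary. *)
Lemma concentrated_hom0 C (n : int) X :
  concentrated C (n + 1) ->
  (forall u : homK C X, u = 0) ->
  hom_exact (C (n + 1)) (diff X (n + 1)) (diff X n).
Proof.
move=> Cn C0 h; split=> [dh|[k kP] x]; last by rewrite kP diffK.
pose f k : {linear C k -> X k} := delta X (n + 1) k \o h \o delta C k (n + 1).
have f_diff (k : int) x : f k (diff C k x) = diff X k (f (k + 1) x).
  rewrite (concentrated_diff _ Cn) linear0.
  have [nk|kn] := eqVneq k n; first by subst k; rewrite /= !delta_id dh.
  by rewrite (Cn _ x) ?linear0 // (inj_eq (addIr _)).
pose F : chmap C X := ChMap f (fun k => linearP (f k)) f_diff.
have /classP[s sP] : class F = class 0.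
  by rewrite (C0 (class F)) (C0 (class 0)).
exists (s (n + 1)) => x.
have := sP n x; rewrite (concentrated_diff _ Cn) linear0 addr0 => <-.
by rewrite /= subr0 !delta_id.
Qed.

Lemma fin_gen_supp (I : choiceType) (V : I -> lmodType R) M
    (f : {linear M -> lsum V}) :
  fin_gen M ->
  exists2 r : seq I, uniq r & forall x i, f x i != 0 -> i \in r.
Proof.
move=> [n [p p_surj]].
have /choice[r rP] (k : 'I_n) : exists r : seq I,
    forall i, f (p (delta_mx 0 k)) i != 0 -> i \in r.
  by have [r _ rP] := dsum_supp (f (p (delta_mx 0 k))); exists r.
exists (undup (flatten [seq r k | k <- enum 'I_n])); first exact: undup_uniq.
move=> x i; rewrite mem_undup; apply: contraNT => i_notin.
have [v _ <-] := p_surj x Logic.I.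
rewrite [v]row_sum_delta !linear_sum -(lsum_projE i) linear_sum big1 // => k _.
rewrite !linearZ_LR lsum_projE.
suff -> : f (p (delta_mx 0 k)) i = 0 by rewrite scaler0.
apply: contraNeq i_notin => /rP i_in; apply/flattenP; exists (r k) => //.
by apply: map_f; rewrite mem_enum.
Qed.

Lemma class_sum X Y (I : Type) (r : seq I) (F : I -> chmap X Y) :
  class (\sum_(i <- r) F i) = \sum_(i <- r) class (F i).
Proof.
apply: (big_morph _ (@classD _ _ X Y)).
by apply: (addrI (class 0)); rewrite -classD !addr0.
Qed.

Lemma chm_sum X Y (I : Type) (r : seq I) (F : I -> chmap X Y) n x :
  (\sum_(i <- r) F i) n x = \sum_(i <- r) F i n x.
Proof. exact: (big_morph (fun f : chmap X Y => f n x)). Qed.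

End Concentrated.

(** A chain map into a direct sum is determined by its component in degree [n],
    which lands in a finite subsum. *)
Lemma concentrated_compact (R : comPzRingType) (A : lmodType R -> Prop)
    (C : complex (Add A)) n :
  concentrated C n -> fin_gen (C n) -> @compact (K (Add A)) C.
Proof.
move=> Cn C_fg; apply: compact_chosen => I X.
exists (sum_complex X), (fun i => class (sum_inj X i)).
split=> [|u]; first exact: sum_complex_coproduct.
pose f : {linear C n -> sum_complex X n} := rep u n.
have [r r_uniq rP] := @fin_gen_supp _ I (fun i => X i n) _ f C_fg.
pose phi_at i : homK C (X i) := class (chmap_comp (sum_proj X i) (rep u)).
have phi_r i : phi_at i != 0 -> i \in r.
  apply: contra_neqT => ir.
  have -> : phi_at i = class 0.
    congr class; apply: (concentrated_eq Cn) => x /=; rewrite lsum_projE.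
    by apply: contraNeq ir => /rP.
  by apply: (addrI (class 0)); rewrite -classD !addr0.
have phi_fin : finite_set [set i | phi_at i != 0].
  by apply: sub_finite_set (finite_seq r) => i /phi_r.
pose phi : dsum (fun i => @hom (K (Add A)) C (X i)) := DSum phi_fin.
exists phi; rewrite (@hom_coprodE _ _ _ _ _ _ phi _ r_uniq phi_r).
apply: etrans (eq_bigr _ (fun i _ => class_comp _ _)) _.
rewrite -[RHS]repK; apply: etrans (esym (class_sum _ _)) _; congr class.
apply: (concentrated_eq Cn) => x; rewrite chm_sum /=.
rewrite [RHS](lsum_decomp r_uniq (rP x)).
by apply: eq_bigr => i _; rewrite lsum_projE.
Qed.

(** * Compact generation *)

(** The quotients of modules of row vectors form a set and represent all finitely
    generated modules; a generator is such a quotient in the class [A], together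
    with the degree in which it is placed. *)
Record generator (R : comPzRingType) (A : lmodType R -> Prop) := Generator {
  gen_size : nat;
  gen_rel : {pred 'rV[R]_gen_size};
  gen_submod : submod_closed gen_rel;
  gen_in : A (quotient gen_submod);
  gen_deg : int }.

Definition gen_complex (R : comPzRingType) (A : lmodType R -> Prop)
    (G : generator A) : complex (Add A) :=
  stalk (Add_gen (gen_in G)) (gen_deg G).

Lemma gen_complex_compact (R : comPzRingType) (A : lmodType R -> Prop)
    (G : generator A) : @compact (K (Add A)) (gen_complex G).
Proof.
apply: (concentrated_compact (@stalk_concentrated _ _ _ _ _)).
have [i [j [_ jK]]] := stalk_iso (Add_gen (gen_in G)) (gen_deg G).
exists (gen_size G), (i \o quot_pi (gen_submod G)) => x _ /=.
by exists (quot_repr (j x)) => //=; rewrite quot_reprK jK.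
Qed.

(** A homomorphism from a finitely presented module to a term of [X] factors
    through its image, which is isomorphic to one of the quotients that define
    the generators. *)
Lemma gen_complex_pure_exact (R : comPzRingType) (A : lmodType R -> Prop)
    (X : complex (Add A)) :
  (forall (n : int) m (K : {pred 'rV[R]_m}) (K_submod : submod_closed K)
     (j : {linear quotient K_submod -> X n}),
     injective j -> A (quotient K_submod)) ->
  (forall (G : generator A) (u : homK (gen_complex G) X), u = 0) ->
  forall n : int, pure_exact (diff X (n + 1)) (diff X n).
Proof.
move=> A_sub G0 n N /fin_pres_gen[m [p p_surj]] h.
split=> [dh|[k kP] x]; last by rewrite kP diffK.
have [K [K_submod [j [j_inj jE]]]] := image_factorization (h \o p).
have AQ := A_sub _ _ _ K_submod j j_inj.
pose G := Generator AQ (n + 1).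
have [i [i' [iK _]]] := stalk_iso (Add_gen AQ) (n + 1).
have [] := concentrated_hom0 (@stalk_concentrated _ _ _ (Add_gen AQ) (n + 1)) (G0 G)
  (j \o i').
case=> [x|k kP _] /=.
  by rewrite -[i' x]quot_reprK jE dh.
have [x|l lP] := @lift_inj _ _ _ _ j h j_inj.
  by have [v _ <-] := p_surj x Logic.I; exists (quot_pi K_submod v); rewrite jE.
exists (k \o (i \o l)) => x /=.
by rewrite -kP /= iK lP.
Qed.

Lemma contractible_zero (R : comPzRingType) (A : lmodType R -> Prop)
    (X : complex A) : null_homotopic (chmap1 X) -> @zero_object (K A) X.
Proof.
move=> X0; have id0 : @idm (K A) X = 0.
  apply: (addrI (class 0)); rewrite addr0 -[LHS]classD; apply/classP.
  by rewrite add0r subr0.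
by split=> Y f; [rewrite -[f]compm1 id0 comp0r | rewrite -[f]comp1m id0 comp0l].
Qed.

Theorem mainTheorem7 (R : comPzRingType) (S : set R) :
  noetherian R -> finite_pure_gldim R -> multiplicative S ->
  (forall M : lmodType R,
     Add (sub (fun N : lmodType R => torsion_free S N)) M <->
     Add (fun N : lmodType R => fin_gen N /\ torsion_free S N) M) /\
  compactly_generated (K (Add (sub (fun N : lmodType R => torsion_free S N)))).
Proof.
move=> R_noeth [d R_d] [S1 _].
have subE N : sub (fun N => torsion_free S N) N <-> fin_gen N /\ torsion_free S N.
  split=> [[N_fp [M [M_tf [f f_inj]]]]|[N_fg N_tf]].
    by split; [apply: fin_pres_gen | apply: torsion_free_inj f_inj M_tf].
  by split; [apply: fin_gen_pres | exists N; split=> //; exists idfun].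
split=> [M|]; first by split; apply: Add_mono => N; apply subE.
set A := sub _; split=> [I X|].
  exists (sum_complex X), (fun i => class (sum_inj X i)).
  exact: sum_complex_coproduct.
exists {classic generator A}, (@gen_complex R A).
split=> [G|X G0]; first exact: gen_complex_compact.
apply: contractible_zero; apply: (pure_exact_contractible R_d) => [n|n].
  by apply: pure_projective_Add (ch_in X n) => N [].
apply: gen_complex_pure_exact n => // n m K K_submod j j_inj; apply/subE.
split; last first.
  apply: (torsion_free_inj S1 j_inj).
  by apply: (torsion_free_Add S1 _ (ch_in X n)) => N /subE[].
exists m, (quot_pi K_submod) => u _.
by exists (quot_repr u); [|apply: quot_reprK].
Qed.
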